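(* There exist universal constants $\eta \ge 2$ and $\theta > 0$ such that the following holds. Let $m, d$ be positive integers and let $w_1, \dots, w_m \in \mathbb{C}^d$ satisfy $\|w_i\| \le 1$ for all $i$, and suppose $$\sum_{i=1}^m |\langle u, w_i\rangle|^2 = \eta$$ for every unit vector $u \in \mathbb{C}^d$. Then there exists a partition $S_1, S_2$ of $\{1,\dots,m\}$ such that $$\sum_{i\in S_j} |\langle u, w_i\rangle|^2 \le \eta - \theta$$ for every unit vector $u\in\mathbb{C}^d$ and each $j\in\{1,2\}$.
   Context: $\|\cdot\|$ and $\langle\cdot,\cdot\rangle$ are the Euclidean norm and standard Hermitian inner product on $\mathbb{C}^d$. ''Universal'' means that $\eta$ and $\theta$ do not depend on $m$, $d$, or the vectors $w_i$. *)

(* Defs.v *)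
From mathcomp Require Import all_boot all_order all_algebra.

Set Implicit Arguments.
Unset Strict Implicit.
Unset Printing Implicit Defensive.

Import Order.TTheory GRing.Theory Num.Theory.
Local Open Scope ring_scope.

(* dotmx u v = \sum_k u 0 k * (v 0 k)^* is linear in u and conjugate-linear
   in v. The norm takes its (nonnegative real) values in C. *)
Definition l2norm (C : numClosedFieldType) (d : nat) (u : 'rV[C]_d) : C :=
  sqrtC (dotmx u u).

(* Main.v *)
Require Import Defs.
From mathcomp Require Import all_boot all_order all_algebra.
From mathcomp Require Import complex.
From mathcomp Require Import reals.
From mathcomp Require Import polyrcf ring lra.

Set Implicit Arguments.
Unset Strict Implicit.
Unset Printing Implicit Defensive.

Import Order.TTheory GRing.Theory Num.Theory.
Local Open Scope ring_scope.

(* The Marcus-Spielman-Srivastava argument, run on multiaffine functions. Put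
   A_j = w_j^* w_j / 18, so that the A_j sum to 1 and have trace at most 1 / 18,
   f(z) = det (\sum_j z_j A_j) and F(z, z') = f(z) f(z'). Being multiaffine,
   F (. - 2 e_k) = F - 2 D_k F, so a partition S1, S2 turns F (x, .., x) into
   det (x - 2 \sum_(S1) A_j) * det (x - 2 \sum_(S2) A_j), and averaging over the
   side of j amounts to applying T_j = 1 - D_j - D_j'. Two facts are needed.
   - Barrier: with d = 4 / 3 and t = 4 / 9, the product of all the T_j maps F to a
     function that is positive on [t + d, +oo) along the diagonal. The potentials
     D_j F / F + D_j' F / F start below 1 - 1 / d at (t, .., t) and do not increase
     when T_j is applied and the coordinates of j are increased by d.
   - Choice: replacing T_j by one of its two terms, for one j at a time, preserves
     positivity on [t + d, +oo) for at least one of the two choices.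
   Hence 2 \sum_(S) A_j <= t + d = 16 / 9 for both parts. Both facts follow from
   the inequality Im (D_k F / F) <= 0 on the upper half-planes, which says that
   F + s D_k F, a translate of F, has no zero there; it is inherited by T_j F. *)

(** * Limits at zero from the right, with a linear rate of convergence *)

Section LinearLimit.
Variable R : rcfType.
Local Notation C := R[i].
Implicit Types (g h : C -> C) (l m : C) (p : {poly C}).

(** An elementary form of [g e -> l] as [e] decreases to 0. The order on [R[i]] forces [e] and [K]
    to be real. *)
Definition lin_lim g l :=
  exists K, forall e, 0 < e <= 1 -> `|g e - l| <= K * e.

Lemma eq_lin_lim g h l :
  (forall e, 0 < e <= 1 -> g e = h e) -> lin_lim g l -> lin_lim h l.
Proof. by move=> gh [K Kg]; exists K => e he; rewrite -gh ?Kg. Qed.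

Lemma lin_lim_cst l : lin_lim (fun=> l) l.
Proof. by exists 0 => e _; rewrite subrr normr0 mul0r. Qed.

Lemma lin_lim_scale l : lin_lim (fun e => l * e) 0.
Proof. by exists `|l| => e /andP[e0 _]; rewrite subr0 normrM (gtr0_norm e0). Qed.

Lemma lin_limD g h l m :
  lin_lim g l -> lin_lim h m -> lin_lim (fun e => g e + h e) (l + m).
Proof.
move=> [K Kg] [L Lh]; exists (K + L) => e he.
by rewrite opprD addrACA mulrDl (le_trans (ler_normD _ _)) ?lerD ?Kg ?Lh.
Qed.

Lemma lin_limM g h l m :
  lin_lim g l -> lin_lim h m -> lin_lim (fun e => g e * h e) (l * m).
Proof.
move=> [K Kg] [L Lh]; exists (K * (L + `|m|) + `|l| * L) => e he.
have e0 : 0 < e by case/andP: he.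
have -> : g e * h e - l * m = (g e - l) * h e + l * (h e - m) by ring.
rewrite (le_trans (ler_normD _ _)) // [leRHS]mulrDl !normrM lerD //.
  have hL : `|h e| <= L + `|m|.
    have L0 : 0 <= L by rewrite -(pmulr_lge0 _ e0) (le_trans _ (Lh e he)).
    rewrite -{1}[h e](subrK m) (le_trans (ler_normD _ _)) // lerD2r.
    by rewrite (le_trans (Lh _ he)) // ler_piMr //; case/andP: he.
  by rewrite mulrAC ler_pM ?Kg.
by rewrite -mulrA ler_wpM2l ?Lh.
Qed.

Lemma lin_lim_conj g l : lin_lim g l -> lin_lim (fun e => (g e)^*) (l^*).
Proof. by move=> [K Kg]; exists K => e he; rewrite -rmorphB norm_conjC Kg. Qed.

Lemma lin_lim_horner p y c : lin_lim (fun e => p.[y + c * e]) p.[y].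
Proof.
elim/poly_ind: p => [|p a IHp].
  by rewrite horner0; apply: eq_lin_lim (lin_lim_cst 0) => e _; rewrite horner0.
have -> : (p * 'X + a%:P).[y] = p.[y] * (y + 0) + a by rewrite !hornerE.
apply: eq_lin_lim (lin_limD (lin_limM IHp (lin_limD (lin_lim_cst y)
  (lin_lim_scale c))) (lin_lim_cst a)).
by move=> e _; rewrite !hornerE.
Qed.

Lemma lin_lim_deriv p y c :
  lin_lim (fun e => (p.[y + c * e] - p.[y]) / e) (c * p^`().[y]).
Proof.
elim/poly_ind: p => [|p a IHp].
  rewrite deriv0 horner0 mulr0; apply: eq_lin_lim (lin_lim_cst 0) => e _.
  by rewrite !horner0 subrr mul0r.
rewrite derivD derivM derivX derivC !hornerE.
have -> : c * (p^`().[y] * y + p.[y]) =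
   c * p^`().[y] * (y + 0) + p.[y] * c by ring.
apply: eq_lin_lim (lin_limD (lin_limM IHp (lin_limD (lin_lim_cst y)
  (lin_lim_scale c))) (lin_lim_cst _)) => e /andP[e0 _].
rewrite !hornerE; field; exact: lt0r_neq0.
Qed.

Lemma lin_lim_Im_le0 g l :
  (forall e : R, 0 < e -> complex.Im (g e%:C%C) <= 0) -> lin_lim g l ->
  complex.Im l <= 0.
Proof.
move=> g0 [K Kg]; rewrite leNgt; apply/negP => l0.
have K0 : 0 <= K.
  have := Kg 1; rewrite mulr1 ltr01 lexx => /(_ isT).
  exact: le_trans.
set k := complex.Re K; have EK : K = k%:C%C by rewrite RRe_real ?ger0_real.
have k0 : 0 <= k by rewrite EK ler0c in K0.
(* This [e] is at most 1 and gives [k * e < Im l], so [Im (g e)] would still be positive. *)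
set e := complex.Im l / (complex.Im l + k + 1).
have den0 : 0 < complex.Im l + k + 1 by lra.
have e0 : 0 < e by rewrite divr_gt0.
have e1 : e <= 1 by rewrite ler_pdivrMr // mul1r; lra.
have /Kg : 0 < e%:C%C <= 1 by rewrite ltcR lecR e0.
rewrite EK -rmorphM /= => le_ke.
have : `|complex.Im (g e%:C%C - l)| <= k * e.
  rewrite -lecR; apply: le_trans le_ke; rewrite normc_def lecR.
  by rewrite -sqrtr_sqr ler_wsqrtr // lerDr sqr_ge0.
have {}g0 := g0 _ e0.
rewrite raddfB /= ler_norml => /andP[+ _].
have ke : k * e < complex.Im l.
  rewrite mulrA ltr_pdivrMr // mulrC ltr_pM2l //; lra.
lra.
Qed.

End LinearLimit.

(** * Real polynomials with nonpositive Wronskian *)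

Section Wronskian.
Variable R : rcfType.
Implicit Types (p q : {poly R}) (a b c d e r x y : R).

Lemma horner_ge0_right p r c :
  r < c -> (forall x, r < x <= c -> 0 <= p.[x]) -> 0 <= p.[r].
Proof.
move=> rc pp; rewrite leNgt; apply/negP => pr.
have [|d d0 dP] := @poly_cont R r p (- p.[r]); first by rewrite oppr_gt0.
pose x := r + Num.min (d / 2) (c - r).
have m0 : 0 < Num.min (d / 2) (c - r) by rewrite lt_min subr_gt0 rc divr_gt0.
have /pp px : r < x <= c.
  by rewrite /x ltrDl m0 -lerBrDl ge_min lexx orbT.
have : `|x - r| < d.
  rewrite /x addrAC subrr add0r gtr0_norm // gt_min; apply/orP; left; lra.
by move=> /dP; rewrite ltr_norml => /andP[_]; lra.
Qed.

Lemma last_root_before p a c : a <= c -> p.[a] <= 0 -> 0 < p.[c] ->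
  exists r, [/\ a <= r, r < c, p.[r] = 0 & forall x, r < x <= c -> 0 < p.[x]].
Proof.
move=> ac pa pc.
have ltac : a < c.
  by rewrite lt_neqAle ac andbT; apply: contraTneq pc => <-; rewrite -leNgt.
have key r : {in `]r, c[, forall z, ~~ root p z} ->
    forall x, r < x <= c -> 0 < p.[x].
  move=> nr x /andP[rx xc]; rewrite ltNge; apply/negP => px.
  have ltxc : x < c.
    by rewrite lt_neqAle xc andbT; apply: contraTneq pc => <-; rewrite -leNgt.
  have [|y yxc ry] := @polyrcf.poly_ivt R p x c xc.
    by rewrite mulr_le0_ge0 // ltW.
  have [xy yc] : x <= y /\ y < c.
    move: yxc; rewrite in_itv /= => /andP[xy yc]; split=> //.
    by rewrite lt_neqAle yc andbT; apply: contraTneq pc => <-; rewrite (eqP ry) ltxx.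
  by have := nr y; rewrite ry in_itv /= (lt_le_trans rx xy) yc => /(_ isT).
case: (prev_rootP p a c) => [p0|y _ py yac /key h|r _ _ /key h].
- by rewrite p0 horner0 ltxx in pc.
- by move: yac; rewrite in_itv => /andP[/= /ltW ay yc]; exists y.
(* Without a root in []a, c[], [p] is positive there, so continuity gives [p.[a] >= 0] and [a]
   itself is the root. *)
exists a; split=> //; apply: le_anti; rewrite pa /=.
by apply: horner_ge0_right ltac _ => x /h/ltW.
Qed.

(** The numerator of the derivative of [q / p]. *)
Definition wronskian p q x := q^`().[x] * p.[x] - q.[x] * p^`().[x].

(** A mean value argument: if [q / p] grew from [a] to [c], a tilted combination [h], zero at [a]
    and positive at [c], would have negative derivative at its last root [r], although [h > 0] just
    after [r]. *)
Lemma ratio_nonincreasing p q a c :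
  (forall x, wronskian p q x <= 0) -> a <= c ->
  (forall x, a <= x <= c -> 0 < p.[x]) -> q.[c] * p.[a] <= q.[a] * p.[c].
Proof.
move=> W ac pp; rewrite leNgt; apply/negP => lt_q.
have pa : 0 < p.[a] by rewrite pp ?lexx.
have pc : 0 < p.[c] by rewrite pp ?lexx ?ac.
have ltac : a < c.
  rewrite lt_neqAle ac andbT; apply: contraTneq lt_q => ->.
  by rewrite ltxx.
pose d := q.[c] * p.[a] - q.[a] * p.[c].
(* With this slope the tilt removes only half of the surplus [d] at [c], yet makes the derivative of
   [h] strictly negative at [r]. *)
pose e := d / 2 / ((c - a) * p.[c]).
have d0 : 0 < d by rewrite subr_gt0.
have den0 : 0 < (c - a) * p.[c] by rewrite mulr_gt0 // subr_gt0.
have e0 : 0 < e by rewrite !divr_gt0.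
pose h := p.[a] *: q - q.[a] *: p - e *: (('X - a%:P) * p).
have ha : h.[a] = 0 by rewrite /h !hornerE /=; ring.
have hc : 0 < h.[c].
  have ee : e * ((c - a) * p.[c]) = d / 2 by rewrite divfK ?gt_eqF.
  by rewrite /h !hornerE /= -mulrA ee /d; move: d0; rewrite /d; lra.
have [|r [ar rc hr hpos]] := last_root_before ac _ hc; first by rewrite ha.
have pr : 0 < p.[r] by rewrite pp ?ar ?ltW.
have : h^`().[r] < 0.
  rewrite -(pmulr_llt0 _ pr).
  have -> : h^`().[r] * p.[r] =
      p.[a] * wronskian p q r - e * p.[r] ^+ 2 + h.[r] * p^`().[r].
    rewrite /wronskian /h !(derivE, hornerE) /=; ring.
  rewrite hr mul0r addr0.
  have := W r; rewrite -(pmulr_rle0 _ pa) => W'.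
  have : 0 < e * p.[r] ^+ 2 by rewrite mulr_gt0 ?exprn_gt0.
  lra.
(* Writing [h = k * ('X - r)], the derivative of [h] at [r] is [k.[r]], and [k > 0] on []r, c]]. *)
have /factor_theorem [k hk] : root h r by apply/eqP.
have -> : h^`().[r] = k.[r].
  by rewrite {1}hk !(derivE, hornerE) /= subrr; ring.
apply/negP; rewrite -leNgt.
apply: horner_ge0_right rc _ => x /[dup] /hpos + /andP[rx _].
by rewrite hk !hornerE /= pmulr_lgt0 ?subr_gt0 // => /ltW.
Qed.

Section MonicDominant.
Variables (n : nat) (p0 : {poly R}).
Hypothesis p0n : (size p0 <= n)%N.
Let p := 'X^n + p0.

Lemma dominant_eventually_gt0 q c : (size q <= n)%N -> 0 < c ->
  exists M, forall x, M <= x -> 0 < (c *: p + q).[x].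
Proof.
move=> qn c0.
have lc : lead_coef (c *: p + q) = c.
  have -> : c *: p + q = c *: 'X^n + (c *: p0 + q).
    by rewrite /p scalerDr addrA.
  have sX : size (c *: 'X^n) = n.+1 by rewrite size_scale ?gt_eqF // size_polyXn.
  rewrite lead_coefDl ?lead_coefZ ?lead_coefXn ?mulr1 // sX ltnS.
  rewrite (leq_trans (size_polyD _ _)) // geq_max qn andbT.
  by rewrite (leq_trans (size_scale_leq _ _)).
have [|M HM] := @poly_pinfty_gt_lc R (c *: p + q); first by rewrite lc.
by exists M => x /HM; rewrite lc; apply: lt_le_trans.
Qed.

(** A negative value of [q / p] could only decrease further, whereas [q / p] tends to 0 at infinity:
    [p] has degree [n] and [q] smaller degree. *)
Lemma wronskian_ge0_above q r : (size q <= n)%N ->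
  (forall x, wronskian p q x <= 0) -> (forall x, r < x -> 0 < p.[x]) ->
  forall x, r < x -> 0 <= q.[x].
Proof.
move=> qn W pp x rx; rewrite leNgt; apply/negP => qx.
have [||M HM] := @dominant_eventually_gt0 (p.[x] *: q) (- q.[x]).
- by rewrite (leq_trans (size_scale_leq _ _)).
- by rewrite oppr_gt0.
pose y := Num.max x M.
have := HM y; rewrite le_max lexx orbT => /(_ isT).
have xy : x <= y by rewrite le_max lexx.
have := @ratio_nonincreasing p q x y W xy.
rewrite !hornerE => h; have /h : forall z, x <= z <= y -> 0 < p.[z].
  by move=> z /andP[xz _]; rewrite pp // (lt_le_trans rx).
lra.
Qed.

(** At the last root [r] of [p], the value of [p - q] is [- q.[r]], which is nonpositive since
    [q >= 0] to the right of [r]; hence [r < b]. *)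
Lemma gt0_above_of_sub q b : (size q <= n)%N ->
  (forall x, wronskian p q x <= 0) -> (forall x, b <= x -> 0 < (p - q).[x]) ->
  forall x, b <= x -> 0 < p.[x].
Proof.
move=> qn W pq x bx; rewrite ltNge; apply/negP => px.
have [|M HM] := @dominant_eventually_gt0 0 1 _ ltr01; first by rewrite size_poly0.
rewrite scale1r addr0 in HM.
pose c := Num.max x M.
have pc : 0 < p.[c] by rewrite HM // le_max lexx orbT.
have xc : x <= c by rewrite le_max lexx.
have [r [xr rc pr rpos]] := last_root_before xc px pc.
have pp y : r < y -> 0 < p.[y].
  move=> ry; have [yc|/ltW cy] := leP y c; first by rewrite rpos ?ry.
  by rewrite HM // (le_trans _ cy) // le_max lexx orbT.
have := pq r (le_trans bx xr); rewrite hornerD hornerN pr sub0r oppr_gt0.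
apply/negP; rewrite -leNgt; apply: horner_ge0_right rc _ => y /andP[ry _].
exact: wronskian_ge0_above pp _ ry.
Qed.

(* If [p - q1 - q2] has no zero to the right of [b], then neither has [p], and
   the nonincreasing ratios [q1 / p], [q2 / p] cannot both reach [1 / 2]. *)
Lemma one_of_two_gt0_above q1 q2 b : (size q1 <= n)%N -> (size q2 <= n)%N ->
  (forall x, wronskian p q1 x <= 0) -> (forall x, wronskian p q2 x <= 0) ->
  (forall x, b <= x -> 0 < p.[x] - q1.[x] - q2.[x]) ->
  (forall x, b <= x -> 0 < p.[x] - 2 * q1.[x]) \/
  (forall x, b <= x -> 0 < p.[x] - 2 * q2.[x]).
Proof.
move=> s1 s2 W1 W2 pq.
have pp : forall x, b <= x -> 0 < p.[x].
  apply: (@gt0_above_of_sub (q1 + q2)) => [|x|x bx].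
  - by rewrite (leq_trans (size_polyD _ _)) // geq_max s1.
  - have := W1 x; have := W2 x; rewrite /wronskian !(derivE, hornerE); lra.
  - by have := pq x bx; rewrite !hornerE; lra.
have half q : (forall x, wronskian p q x <= 0) -> 2 * q.[b] < p.[b] ->
    forall x, b <= x -> 0 < p.[x] - 2 * q.[x].
  move=> W qb x bx.
  have h : q.[x] * p.[b] <= q.[b] * p.[x].
    by apply: ratio_nonincreasing => // y /andP[by_ _]; apply: pp.
  have pb := pp b (lexx b); have px := pp x bx.
  rewrite -(pmulr_rgt0 _ pb); nra.
have [h|h] := ltP (2 * q1.[b]) p.[b]; first by left; apply: half.
by right; apply: half => //; have := pq b (lexx b); lra.
Qed.
End MonicDominant.
End Wronskian.

(** * Differences of multiaffine functions *)

Section Multiaffine.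
Variables (K : comNzRingType) (I : finType).
Local Notation point := {ffun I -> K}.
Implicit Types (F G : point -> K) (z v : point) (k l m n : I) (t s : K).

Definition axis k t : point := [ffun j => if j == k then t else 0].

Definition diagonal t : point := [ffun=> t].

(** For [F] affine in coordinate [k], this unit difference is the partial derivative [D_k F]. *)
Definition partial F k z := F (z + axis k 1) - F z.

Definition pair_partial F k l z := partial F k z + partial F l z.

(* For [F] multiaffine, the average of [F] over the translations by [-2] of one
   of the coordinates [k] and [l]. *)
Definition mix F k l z := F z - pair_partial F k l z.

Definition multiaffine F :=
  forall z k t, F (z + axis k t) = F z + t * partial F k z.

Lemma partialC F k l z : partial (partial F k) l z = partial (partial F l) k z.
Proof. rewrite /partial [z + axis l 1 + _]addrAC; ring. Qed.

Lemma multiaffine_translate F v :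
  multiaffine F -> multiaffine (fun z => F (z + v)).
Proof. by move=> aF z k t; rewrite addrAC aF /partial [_ + axis k 1]addrAC. Qed.

Lemma multiaffine_partial F k : multiaffine F -> multiaffine (partial F k).
Proof.
move=> aF z l t; rewrite {1 3}/partial [z + axis l t + _]addrAC !aF /partial.
rewrite [z + axis l 1 + _]addrAC; ring.
Qed.

Lemma multiaffineD F G :
  multiaffine F -> multiaffine G -> multiaffine (fun z => F z + G z).
Proof. by move=> aF aG z k t; rewrite /partial aF aG /partial; ring. Qed.

Lemma multiaffineB F G :
  multiaffine F -> multiaffine G -> multiaffine (fun z => F z - G z).
Proof. by move=> aF aG z k t; rewrite /partial aF aG /partial; ring. Qed.

Lemma multiaffine_pair_partial F k l :
  multiaffine F -> multiaffine (pair_partial F k l).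
Proof. by move=> aF; apply: multiaffineD; apply: multiaffine_partial. Qed.

Lemma multiaffine_mix F k l : multiaffine F -> multiaffine (mix F k l).
Proof. by move=> aF; apply/multiaffineB/multiaffine_pair_partial. Qed.

Lemma multiaffine2 F z k l s : multiaffine F ->
  F (z + axis k s + axis l s) =
    F z + s * pair_partial F k l z + s ^+ 2 * partial (partial F k) l z.
Proof.
move=> aF; rewrite aF aF (multiaffine_partial l aF) /pair_partial.
rewrite [in RHS]partialC; ring.
Qed.

Lemma pair_partial_mix F k l m n z :
  pair_partial (mix F k l) m n z = mix (pair_partial F m n) k l z.
Proof.
rewrite /mix /pair_partial /partial ![z + axis k 1 + _]addrAC.
by rewrite ![z + axis l 1 + _]addrAC; ring.
Qed.

End Multiaffine.

Arguments diagonal {K I} t.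

(** * Real stable multiaffine functions *)

Section StableMultiaffine.
Variables (R : rcfType) (I : finType).
Local Notation C := R[i].
Local Notation cpoint := {ffun I -> C}.
Local Notation rpoint := {ffun I -> R}.
Local Notation Im := (@complex.Im R).
Local Notation Re := (@complex.Re R).
Implicit Types (F : cpoint -> C) (z : cpoint) (u v w y : rpoint) (k l : I) (N : nat).

Definition embed y : cpoint := [ffun k => (y k)%:C%C].

(* Real stable multiaffine polynomials, represented by their evaluation functions. *)
Record stable N F : Prop := Stable {
  stable_multiaffine : multiaffine F;
  stable_neq0 : forall z, (forall k, 0 < Im (z k)) -> F z != 0;
  stable_conj : forall z, F [ffun k => (z k)^*] = (F z)^*;
  stable_monic : forall z, exists2 q : {poly C},
    (size q <= N)%N & forall x : C, F (z + diagonal x) = x ^+ N + q.[x] }.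

Definition real_part F y : R := Re (F (embed y)).

Lemma embedD u v : embed (u + v) = embed u + embed v.
Proof. by apply/ffunP=> k; rewrite !ffunE rmorphD. Qed.

Lemma embed_axis k t : embed (axis k t) = axis k t%:C%C.
Proof. by apply/ffunP=> j; rewrite !ffunE; case: eqP. Qed.

Lemma embed_diagonal x : embed (diagonal x) = diagonal x%:C%C.
Proof. by apply/ffunP=> j; rewrite !ffunE. Qed.

Lemma stable_translate N F v :
  stable N F -> stable N (fun z => F (z + embed v)).
Proof.
case=> aF nF cF mF; split.
- exact: multiaffine_translate.
- by move=> z z0; apply: nF => k; rewrite !ffunE raddfD /= addr0.
- move=> z; rewrite -cF; congr F; apply/ffunP=> k; rewrite !ffunE rmorphD /=.
  by congr (_ + _); rewrite -[RHS]/(((v k)%:C)^*)%C conjc_real.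
- by move=> z; have [q sq qE] := mF (z + embed v); exists q => // x; rewrite addrAC.
Qed.

Lemma Im_mulNJ (d t : C) :
  Im (d * (- (t * d))^*) = Im t * (Re d ^+ 2 + Im d ^+ 2).
Proof.
case: d => a b; case: t => x y.
rewrite -[(- _)^*]/((- ((x +i* y) * (a +i* b)))^*)%C; simpc => /=; ring.
Qed.

(* If [Im (F' / F) >= 0] at [z] for a partial derivative [F' != 0], then moving the
   coordinate by [- F / F'], which lies in the closed upper half-plane, is a zero. *)
Lemma stable_partial_Im_lt0 N F k z : stable N F -> (forall j, 0 < Im (z j)) ->
  partial F k z = 0 \/ Im (partial F k z * (F z)^*) < 0.
Proof.
move=> sF z0; have [->|d0] := eqVneq (partial F k z) 0; [by left|right].
rewrite ltNge; apply/negP => imF.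
pose t := - F z / partial F k z.
have Ft : F z = - (t * partial F k z) by rewrite /t divfK // opprK.
have t0 : 0 <= Im t.
  move: imF; rewrite Ft Im_mulNJ pmulr_lge0 //.
  have : (Re (partial F k z) ^+ 2 + Im (partial F k z) ^+ 2)%:C%C != 0.
    by rewrite add_Re2_Im2 expf_neq0 // normr_eq0.
  rewrite -(rmorph0 (real_complex R)) (inj_eq (@complexI R)) => n0.
  by rewrite lt_neqAle eq_sym n0 addr_ge0 ?sqr_ge0.
have /negP[] : F (z + axis k t) != 0.
  apply: stable_neq0 sF _ _ => j; rewrite !ffunE raddfD /=.
  by rewrite ltr_wpDr //; case: eqP.
by rewrite (stable_multiaffine sF) Ft addNr.
Qed.

(** At a zero in the open upper half-planes, [F = D_k F + D_l F]. Multiplied by [F^*] the left side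
    is real, while each term on the right vanishes or has negative imaginary part; so both vanish
    and [F = 0], a contradiction. *)
Lemma stable_mix N F k l : stable N F -> stable N (mix F k l).
Proof.
move=> sF; have [aF nF cF mF] := sF; split.
- exact: multiaffine_mix.
- move=> z z0; apply/negP; rewrite subr_eq0 => /eqP Fz.
  have := congr1 (fun x => Im (x * (F z)^*)) Fz.
  rewrite mulrDl raddfD /= -[X in X = _]/(Im (F z * (F z)^*)) -normCK.
  rewrite -add_Re2_Im2 /=.
  have [d1|] := stable_partial_Im_lt0 k sF z0; last first.
    have [->|] := stable_partial_Im_lt0 l sF z0; rewrite ?mul0r /=; lra.
  have [d2|] := stable_partial_Im_lt0 l sF z0; last by rewrite d1 mul0r /=; lra.
  by have /negP[] := nF z z0; rewrite Fz /pair_partial d1 d2 addr0.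
- move=> z; rewrite /mix /pair_partial /partial.
  have E j : [ffun k => (z k)^*] + axis j 1 = [ffun k => ((z + axis j 1) k)^*].
    apply/ffunP=> i; rewrite !ffunE rmorphD; congr (_ + _).
    by case: eqP => _; rewrite ?rmorph1 ?rmorph0.
  by rewrite !E !cF !(rmorphB, rmorphD).
move=> z; have [q sq qE] := mF z.
have [q1 sq1 q1E] := mF (z + axis k 1); have [q2 sq2 q2E] := mF (z + axis l 1).
exists (q - (q1 - q) - (q2 - q)).
  have sB (p r : {poly C}) : (size p <= N)%N -> (size r <= N)%N ->
      (size (p - r)%R <= N)%N.
    by move=> sp sr; rewrite (leq_trans (size_polyD _ _)) // geq_max sp size_polyN.
  by rewrite !sB.
move=> x; rewrite /mix /pair_partial /partial ![z + diagonal x + _]addrAC.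
rewrite qE q1E q2E !(hornerD, hornerN); ring.
Qed.

(** On the line [z + diagonal x] both functions are polynomials in [x], so the inequality known at
    [x = 'i * e] passes to the limit [e -> 0]. *)
Lemma stable_partial_Im_le0 N F k z : stable N F -> (forall j, 0 <= Im (z j)) ->
  Im (partial F k z * (F z)^*) <= 0.
Proof.
move=> sF z0.
have [q sq qE] := stable_monic sF z.
have [q1 sq1 q1E] := stable_monic sF (z + axis k 1).
have E x : partial F k (z + diagonal x) = (q1 - q).[x].
  rewrite /partial [z + diagonal x + _]addrAC qE q1E hornerD hornerN; ring.
have E' x : F (z + diagonal x) = ('X^N + q).[x] by rewrite qE hornerD hornerXn.
have z0E : z = z + diagonal 0.
  by apply/ffunP=> j; rewrite !ffunE addr0.
rewrite z0E E E'.
apply: lin_lim_Im_le0 (lin_limM (lin_lim_horner _ 0 'i)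
   (lin_lim_conj (lin_lim_horner _ 0 'i))) => e e0.
rewrite -E' -E; have ze j : 0 < Im ((z + diagonal (0 + 'i * e%:C%C)) j).
  rewrite !ffunE -complexiE; simpc; rewrite raddfD /=.
  by rewrite ltr_wpDl.
by have [->|/ltW //] := stable_partial_Im_lt0 k sF ze; rewrite mul0r.
Qed.

End StableMultiaffine.

(** * A convexity inequality for ratios of quadratics *)

Section QuadraticConvexity.
Variable R : realFieldType.
Implicit Types (p q w d : R).

(** Here [s] and [s ^+ 2 + t] stand for [Re x] and [|x|^2] with [x] in the upper half-plane. Large
    [t] gives the sign of [w3]; [t -> 0] leaves a quadratic in [s] that is nowhere positive, whence
    the discriminant condition. *)
Lemma half_plane_form_le0 w1 w2 w3 :
  (forall s t, 0 < t -> w1 + 2 * s * w2 + w3 * (s ^+ 2 + t) <= 0) ->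
  [/\ w1 <= 0, w3 <= 0 & w2 ^+ 2 <= w1 * w3].
Proof.
move=> h.
have w3_le0 : w3 <= 0.
  rewrite leNgt; apply/negP => w3_gt0.
  have t0 : 0 < (`|w1| + 1) / w3 by rewrite divr_gt0 // ltr_wpDl.
  have := h 0 _ t0; rewrite expr0n add0r mulr0 mul0r addr0 mulrC divfK ?gt_eqF //.
  by have := ler_norm (- w1); rewrite normrN; lra.
have lim (a b : R) : (forall t, 0 < t -> a + b * t <= 0) -> a <= 0.
  move=> ab; rewrite leNgt; apply/negP => a0.
  have b1 : 0 < 2 * (`|b| + 1) by rewrite mulr_gt0 ?ltr_wpDl.
  have t0 := divr_gt0 a0 b1; have := ab _ t0.
  have := divfK (lt0r_neq0 b1) a; set t := a / _ in t0 * => ta.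
  have : - b * t <= `|b| * t by rewrite ler_pM2r // -normrN ler_norm.
  nra.
have {}h s : w1 + 2 * s * w2 + w3 * s ^+ 2 <= 0.
  by apply: (lim _ w3) => t t0; rewrite -addrA -mulrDr h.
have w1_le0 : w1 <= 0 by have := h 0; rewrite expr0n !mulr0 mul0r !addr0.
split=> //; have [w3z|w3n] := eqVneq w3 0; last first.
  have lt3 : w3 < 0 by rewrite lt_neqAle w3n.
  have := h (- w2 / w3); rewrite -(nmulr_lge0 _ lt3).
  have -> : (w1 + 2 * (- w2 / w3) * w2 + w3 * (- w2 / w3) ^+ 2) * w3 =
     w1 * w3 - w2 ^+ 2 by field.
  by rewrite subr_ge0.
suff -> : w2 = 0 by rewrite w3z expr0n mulr0.
apply/eqP; apply: contraT => w2n.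
have := h ((1 - w1) / (2 * w2)); rewrite w3z mul0r addr0.
have -> : 2 * ((1 - w1) / (2 * w2)) * w2 = 1 - w1 by field.
lra.
Qed.

(* Tangent inequality at the right end of [-d, 0] for the convex function q / p,
   combined with the bound p1 / p0 <= 1 - 1 / d on the potential there. *)
Lemma quadratic_shift_ratio p0 p1 p2 q0 q1 q2 d :
  let w1 := q1 * p0 - q0 * p1 in let w2 := q2 * p0 - q0 * p2 in
  let w3 := q2 * p1 - q1 * p2 in
  (forall s t, 0 < t -> w1 + 2 * s * w2 + w3 * (s ^+ 2 + t) <= 0) ->
  0 < d -> 0 <= p1 -> 0 <= p2 ->
  (forall s, 0 <= s <= d -> 0 < p0 - p1 * s + p2 * s ^+ 2) ->
  p0 <= d * (p0 - p1) ->
  (q0 - q1) * (p0 - p1 * d + p2 * d ^+ 2) <=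
  (q0 - q1 * d + q2 * d ^+ 2) * (p0 - p1).
Proof.
move=> w1 w2 w3 /half_plane_form_le0[w1_le0 w3_le0 disc] d0 p1_ge0 p2_ge0 pp pd.
have p0_gt0 : 0 < p0.
  by have := pp 0; rewrite lexx ltW // expr0n !mulr0 subr0 addr0; apply.
have Pd : 0 < p0 - p1 * d + p2 * d ^+ 2 by rewrite pp // lexx ltW.
(* The [w]s are the 2 by 2 minors of the rows [p] and [q]; this expands a 3 by 3 determinant with a
   repeated row. *)
have plucker : p0 * w3 - p1 * w2 + p2 * w1 = 0 by rewrite /w1 /w2 /w3; ring.
(* Eliminating [w3] from [disc] yields, with [v = w2 / w1], that the quadratic [p0 - p1 s + p2 s^2]
   is not positive at [s = 1 / v]. *)
have res : p0 * w2 ^+ 2 - p1 * w1 * w2 + p2 * w1 ^+ 2 <= 0.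
  have -> : p0 * w2 ^+ 2 - p1 * w1 * w2 + p2 * w1 ^+ 2 =
    p0 * (w2 ^+ 2 - w1 * w3) + w1 * (p0 * w3 - p1 * w2 + p2 * w1) by ring.
  by rewrite plucker mulr0 addr0 pmulr_rle0 // subr_le0.
have X : 0 <= p0 * w2 - p1 * w1 + p2 * w1 * d.
  have [w1z|w1n] := eqVneq w1 0.
    have : w2 ^+ 2 <= 0 by rewrite (le_trans disc) // w1z mul0r.
    rewrite real_exprn_even_le0 ?num_real //= => /eqP ->; rewrite w1z; lra.
  have w1_lt0 : w1 < 0 by rewrite lt_neqAle w1n.
  pose v := w2 / w1; have w2E : w2 = v * w1 by rewrite divfK.
  have resv : p0 * v ^+ 2 - p1 * v + p2 <= 0.
    have sq : 0 < w1 ^+ 2 by rewrite exprn_even_gt0.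
    rewrite -(pmulr_lle0 _ sq); apply: le_trans res.
    by rewrite w2E le_eqVlt; apply/orP; left; apply/eqP; ring.
  have -> : p0 * w2 - p1 * w1 + p2 * w1 * d = w1 * (p0 * v - p1 + p2 * d).
    by rewrite w2E; ring.
  rewrite nmulr_rge0 //.
  have v_ge0 : 0 <= v.
    rewrite leNgt; apply/negP => v0.
    have : 0 < p0 * v ^+ 2 by rewrite mulr_gt0 // exprn_even_gt0 //= lt_eqF.
    have : p1 * v <= 0 by rewrite mulr_ge0_le0 // ltW.
    lra.
  have [vz|vn] := eqVneq v 0.
    by move: resv; rewrite vz expr0n !mulr0 subr0 add0r => resv; nra.
  have v_gt0 : 0 < v by rewrite lt_neqAle eq_sym vn.
  (* If [v * d <= 1], then [resv] bounds [v] times the goal. Otherwise [1 / v] lies in [[0, d]],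
     where the quadratic is positive, against [resv]. *)
  have [vd|vd] := leP (v * d) 1.
    rewrite -(pmulr_lle0 _ v_gt0); nra.
  have vd' : v^-1 <= d by rewrite -div1r ler_pdivrMr // mulrC ltW.
  have := pp v^-1; rewrite invr_ge0 v_ge0 vd' => /(_ isT).
  have sq : 0 < v ^+ 2 by rewrite exprn_gt0.
  rewrite -(pmulr_rgt0 _ sq).
  have -> : v ^+ 2 * (p0 - p1 / v + p2 * v^-1 ^+ 2) = p0 * v ^+ 2 - p1 * v + p2.
    by field.
  lra.
set P := p0 - p1 * d + p2 * d ^+ 2 in Pd *.
(* The gap times [p0 ^ 2] is a sum of two terms, nonnegative by the potential bound [pd] and by [X]
   respectively. *)
rewrite -subr_ge0 -(pmulr_lge0 _ (mulr_gt0 p0_gt0 p0_gt0)).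
have -> : ((q0 - q1 * d + q2 * d ^+ 2) * (p0 - p1) - (q0 - q1) * P) * (p0 * p0) =
    (- w1) * P * (d * (p0 - p1) - p0) +
    (p0 - p1) * d ^+ 2 * (p0 * w2 - p1 * w1 + p2 * w1 * d).
  rewrite /P /w1 /w2; ring.
have pp1 : 0 <= p0 - p1 by rewrite -(pmulr_rge0 _ d0) (le_trans (ltW p0_gt0)).
apply: addr_ge0; apply: mulr_ge0; rewrite ?subr_ge0 //; apply: mulr_ge0 => //.
- by rewrite oppr_ge0.
- exact: ltW.
- by rewrite exprn_ge0 ?ltW.
Qed.
End QuadraticConvexity.

(** * The barrier argument: potentials under shifts *)

Section Barrier.
Variables (R : rcfType) (I : finType).
Local Notation C := R[i].
Local Notation rpoint := {ffun I -> R}.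
Implicit Types (F : {ffun I -> C} -> C) (g : rpoint -> R).
Implicit Types (u v w y : rpoint) (k l m n : I) (N : nat) (s t d : R).

Definition realizes F g := forall y, F (embed y) = (g y)%:C%C.

Lemma realizes_partial F g k : realizes F g -> realizes (partial F k) (partial g k).
Proof.
move=> Fg y; rewrite /partial -(rmorph1 (real_complex R)) -embed_axis -embedD !Fg.
by rewrite rmorphB.
Qed.

Lemma realizes_pair_partial F g k l :
  realizes F g -> realizes (pair_partial F k l) (pair_partial g k l).
Proof.
by move=> Fg y; rewrite /pair_partial !(realizes_partial _ Fg) [RHS]rmorphD.
Qed.

Lemma realizes_mix F g k l : realizes F g -> realizes (mix F k l) (mix g k l).
Proof.
by move=> Fg y; rewrite /mix (realizes_pair_partial _ _ Fg) Fg [RHS]rmorphB.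
Qed.

Lemma realizes_translate F g v : realizes F g ->
  realizes (fun z => F (z + embed v)) (fun y => g (y + v)).
Proof. by move=> Fg y; rewrite -embedD Fg. Qed.

Lemma realizes_multiaffine F g : realizes F g -> multiaffine F -> multiaffine g.
Proof.
move=> Fg aF y k t; apply: (@complexI R); rewrite -Fg embedD embed_axis aF Fg.
by rewrite (realizes_partial _ Fg) [RHS]rmorphD; congr (_ + _); rewrite rmorphM.
Qed.

Lemma Im_affine_i (a b c d : R) :
  complex.Im ((c%:C + 'i * d%:C) * (a%:C + 'i * b%:C)^*)%C = d * a - c * b.
Proof. by simpc => /=; ring. Qed.

Lemma Im_quadratic (p0 p1 p2 q0 q1 q2 s t : R) :
  complex.Im ((q0%:C + (s +i* t) * q1%:C + (s +i* t) ^+ 2 * q2%:C) *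
    (p0%:C + (s +i* t) * p1%:C + (s +i* t) ^+ 2 * p2%:C)^*)%C =
  t * (q1 * p0 - q0 * p1 + 2 * s * (q2 * p0 - q0 * p2) +
       (q2 * p1 - q1 * p2) * (s ^+ 2 + t ^+ 2)).
Proof. by rewrite !expr2; simpc => /=; ring. Qed.

Section Stable.
Variables (N : nat) (F : {ffun I -> C} -> C) (g : rpoint -> R).
Hypotheses (sF : stable N F) (Fg : realizes F g).
Let aF : multiaffine F := stable_multiaffine sF.
Let ag : multiaffine g := realizes_multiaffine Fg aF.

(** At [y + 'i e_l] both [F] and [D_k F] are affine in ['i] with real coefficients, and
    [Im (F^* * D_k F) <= 0] becomes this Rayleigh inequality. *)
Lemma rayleigh k l y :
  partial (partial g k) l y * g y <= partial g k y * partial g l y.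
Proof.
have z0 j : 0 <= complex.Im ((embed y + axis l 'i%C) j).
  by rewrite !ffunE raddfD /= add0r; case: eqP => //= _; apply: ler01.
have := stable_partial_Im_le0 k sF z0.
rewrite (multiaffine_partial k aF) aF Fg !(realizes_partial _ Fg).
rewrite (realizes_partial _ (realizes_partial _ Fg)).
by rewrite -[(_ + _)^*]/((_ + _)^*)%C Im_affine_i subr_le0.
Qed.

(** The imaginary part inequality, summed over [m] and [n], at [y + x e_k + x e_l] with
    [x = s + 'i sqrt t], divided by [Im x]. It supplies the form hypothesis of
    [quadratic_shift_ratio]. *)
Lemma pair_quadratic_form k l m n y s t : 0 < t ->
  let h := pair_partial g m n in
  let p0 := g y in let p1 := pair_partial g k l y in
  let p2 := partial (partial g k) l y in
  let q0 := h y in let q1 := pair_partial h k l y in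
  let q2 := partial (partial h k) l y in
  q1 * p0 - q0 * p1 + 2 * s * (q2 * p0 - q0 * p2) +
    (q2 * p1 - q1 * p2) * (s ^+ 2 + t) <= 0.
Proof.
move=> t0 /=; set x := (s +i* Num.sqrt t)%C.
have z0 j : 0 <= complex.Im ((embed y + axis k x + axis l x) j).
  rewrite !ffunE !raddfD /= add0r.
  by rewrite addr_ge0 //; case: eqP => //= _; rewrite sqrtr_ge0.
set h := pair_partial g m n; have hF := realizes_pair_partial m n Fg.
have := lerD (stable_partial_Im_le0 m sF z0) (stable_partial_Im_le0 n sF z0).
have ImD (a b : C) : complex.Im (a + b) = complex.Im a + complex.Im b.
  by rewrite raddfD.
rewrite addr0 -ImD -mulrDl -[_ + _]/(pair_partial F m n _).
rewrite !multiaffine2 //; last exact: multiaffine_pair_partial.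
rewrite Fg hF !(realizes_pair_partial _ _ Fg, realizes_pair_partial _ _ hF).
rewrite (realizes_partial _ (realizes_partial _ Fg)).
rewrite (realizes_partial _ (realizes_partial _ hF)).
rewrite -[(_ + _)^*]/((_ + _)^*)%C /x Im_quadratic sqr_sqrtr ?(ltW t0) //.
by rewrite pmulr_rle0 // sqrtr_gt0.
Qed.

End Stable.

Lemma orthant_ind (rel : rpoint -> rpoint -> Prop) :
  (forall y, rel y y) -> (forall u v w, rel u v -> rel v w -> rel u w) ->
  (forall y k t, 0 <= t -> rel y (y + axis k t)) ->
  forall y v, (forall k, 0 <= v k) -> rel y (y + v).
Proof.
move=> rel_refl rel_trans rel_axis y v v0.
have -> : v = \sum_(k <- enum I) axis k (v k).
  apply/ffunP=> j; rewrite big_enum sum_ffunE (bigD1 j) //= ffunE eqxx.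
  by rewrite big1 ?addr0 // => k /negPf kj; rewrite ffunE eq_sym kj.
elim: (enum I) y => [|k r IHr] y; first by rewrite big_nil addr0.
by rewrite big_cons addrA; apply: rel_trans (IHr _); apply: rel_axis.
Qed.

(** In barrier language, [y] lies above the zeros of [g]. *)
Definition above g y := forall v, (forall k, 0 <= v k) -> 0 < g (y + v).

Lemma above_gt0 g y : above g y -> 0 < g y.
Proof. by move=> gy; rewrite -[y]addr0 gy // => k; rewrite ffunE. Qed.

Lemma aboveD g y v : above g y -> (forall k, 0 <= v k) -> above g (y + v).
Proof. by move=> gy v0 u u0; rewrite -addrA gy // => k; rewrite ffunE addr_ge0. Qed.

Lemma axis_ge0 k t : 0 <= t -> forall j, 0 <= (axis k t : rpoint) j.
Proof. by move=> t0 j; rewrite ffunE; case: eqP. Qed.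

Section Affine.
Variable g : rpoint -> R.
Hypothesis ag : multiaffine g.

Lemma affine_slope_ge0 (a b : R) : (forall t, 0 <= t -> 0 <= a + t * b) -> 0 <= b.
Proof.
move=> h; rewrite leNgt; apply/negP => b0.
have t0 : 0 <= (`|a| + 1) / - b by rewrite divr_ge0 ?addr_ge0 // oppr_ge0 ltW.
have := h _ t0; rewrite -[X in _ * X]opprK mulrN divfK ?oppr_eq0 ?lt_eqF //.
by have := ler_norm a; lra.
Qed.

Lemma above_partial_ge0 k y : above g y -> 0 <= partial g k y.
Proof.
move=> gy; apply: (@affine_slope_ge0 (g y)) => t t0.
by rewrite -ag ltW // gy //; apply: axis_ge0.
Qed.

Lemma above_partial2_ge0 k l y : above g y -> 0 <= partial (partial g k) l y.
Proof.
move=> gy; apply: (@affine_slope_ge0 (partial g k y)) => t t0.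
rewrite -(multiaffine_partial k ag); apply/above_partial_ge0/aboveD => //.
exact: axis_ge0.
Qed.

End Affine.

Section Step.
Variables (N : nat) (F : {ffun I -> C} -> C) (g : rpoint -> R).
Hypotheses (sF : stable N F) (Fg : realizes F g).
Let ag : multiaffine g := realizes_multiaffine Fg (stable_multiaffine sF).

(** Along one axis the difference is [t] times a Rayleigh difference; the axes are then chained.
    Positivity is carried along because chaining cancels [g] at the intermediate point. *)
Lemma potential_nonincreasing m n y v : above g y -> (forall k, 0 <= v k) ->
  pair_partial g m n (y + v) * g y <= pair_partial g m n y * g (y + v).
Proof.
move=> gy v0.
suff [] : above g (y + v) /\
  pair_partial g m n (y + v) * g y <= pair_partial g m n y * g (y + v) by [].
move: gy.
apply: (@orthant_ind (fun y y' => above g y -> above g y' /\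
  pair_partial g m n y' * g y <= pair_partial g m n y * g y')) v0 => {y v}.
- by move=> y gy.
- move=> u v w uv vw gu; have [gv le_uv] := uv gu; have [gw le_vw] := vw gv.
  split=> //; have := above_gt0 gu; have := above_gt0 gv; have := above_gt0 gw.
  move: le_uv le_vw; set a := pair_partial g m n u; set b := pair_partial g m n v.
  set c := pair_partial g m n w => le_uv le_vw w0 v0 u0.
  rewrite -(ler_pM2r v0) mulrAC; apply: (@le_trans _ _ (b * g w * g u)).
    by rewrite ler_pM2r.
  by rewrite mulrAC [leRHS]mulrAC ler_pM2r.
move=> y k t t0 gy; split; first by apply: aboveD gy _; apply: axis_ge0.
have ray j : partial g j (y + axis k t) * g y <= partial g j y * g (y + axis k t).
  rewrite (multiaffine_partial j ag) (ag y) -subr_ge0.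
  rewrite [X in 0 <= X](_ : _ = t * (partial g j y * partial g k y -
    partial (partial g j) k y * g y)); last by ring.
  by rewrite mulr_ge0 // subr_ge0 (rayleigh sF Fg).
by rewrite /pair_partial [leLHS]mulrDl [leRHS]mulrDl lerD ?ray.
Qed.

(** The potential of [k], [l] stays at most [1 - 1 / d] above [y], so [mix g >= g / d > 0] there.
    For the other potentials, [mix] commutes with [pair_partial], and [quadratic_shift_ratio]
    applies to the expansion around [y'] along [- s (e_k + e_l)], which is back at [y] for
    [s = d]. *)
Lemma barrier_step k l y d : 0 < d -> above g y ->
  d * pair_partial g k l y <= (d - 1) * g y ->
  let y' := y + axis k d + axis l d in
  above (mix g k l) y' /\ forall m n,
    pair_partial (mix g k l) m n y' * g y <= pair_partial g m n y * mix g k l y'.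
Proof.
move=> d0 gy potential y'.
have y0 := above_gt0 gy.
have y'D s : g (y' - axis k s - axis l s) = g (y + (axis k (d - s) + axis l (d - s))).
  by congr g; apply/ffunP=> j; rewrite !ffunE; do 2 case: eqP => _; ring.
have axis2 s : 0 <= s -> forall j, 0 <= (axis k s + axis l s : rpoint) j.
  by move=> s0 j; rewrite ffunE addr_ge0 ?axis_ge0.
have gy' : above g y' by rewrite /y' -addrA; apply: aboveD => //; apply/axis2/ltW.
have mix_gt v : (forall j, 0 <= v j) -> g (y + v) <= d * mix g k l (y + v).
  move=> v0; have := potential_nonincreasing k l gy v0.
  have yv : 0 < g (y + v) by apply: gy.
  rewrite -(ler_pM2l d0) => h.
  have h2 : d * (pair_partial g k l y * g (y + v)) <= (d - 1) * g y * g (y + v).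
    by rewrite mulrA ler_pM2r.
  have h3 : d * pair_partial g k l (y + v) <= (d - 1) * g (y + v).
    rewrite -(ler_pM2r y0) -mulrA (le_trans h) // (le_trans h2) //.
    by rewrite mulrAC.
  rewrite /mix mulrBr; move: h3; lra.
split=> [v v0|m n].
  have v0' j : 0 <= (axis k d + axis l d + v) j.
    by rewrite ffunE addr_ge0 ?axis2 // ltW.
  rewrite -(pmulr_rgt0 _ d0) /y' -(addrA y) -(addrA y).
  by apply: lt_le_trans (mix_gt _ v0'); apply: gy.
pose h := pair_partial g m n.
have ah : multiaffine h by apply: multiaffine_pair_partial.
have neg G s : multiaffine G -> G (y' - axis k s - axis l s) =
    G y' - pair_partial G k l y' * s + partial (partial G k) l y' * s ^+ 2.
  move=> aG; have E j : - axis j s = axis j (- s) :> rpoint.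
    by apply/ffunP=> i; rewrite !ffunE; case: eqP; rewrite ?oppr0.
  by rewrite !E multiaffine2 //; ring.
have E G : G (y' - axis k d - axis l d) = G y :> R.
  by congr G; apply/ffunP=> j; rewrite !ffunE; ring.
rewrite pair_partial_mix -/h -(E g) -[h y](E h) !neg //.
apply: quadratic_shift_ratio => //.
- by move=> s t t0; apply: (pair_quadratic_form sF Fg).
- by rewrite addr_ge0 ?above_partial_ge0.
- exact: above_partial2_ge0.
- move=> s /andP[s0 sd]; rewrite -neg // y'D gy //.
  by apply: axis2; rewrite subr_ge0.
- by rewrite -[_ - _]/(mix g k l y') /y' -(addrA y) mix_gt //; apply/axis2/ltW.
Qed.

End Step.

End Barrier.

(** * Restriction to the diagonal *)

Section DiagonalRestriction.
Variables (R : rcfType) (I : finType).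
Local Notation C := R[i].
Implicit Types (p q : {poly C}) (x y : R).

Definition re_poly p : {poly R} := map_poly (@complex.Re R) p.

Lemma size_re_poly p : (size (re_poly p) <= size p)%N.
Proof. exact: size_poly. Qed.

Lemma horner_re_poly p x : (re_poly p).[x] = complex.Re p.[x%:C%C].
Proof.
rewrite (horner_coef_wide _ (size_re_poly p)) horner_coef raddf_sum /=.
apply: eq_bigr => i _; rewrite coef_map -rmorphXn.
by case: (p`_i) => a b; simpc.
Qed.

Lemma deriv_re_poly p : (re_poly p)^`() = re_poly p^`().
Proof. by apply/polyP=> i; rewrite !(coef_deriv, coef_map) raddfMn. Qed.

Lemma re_polyXnD n p : re_poly ('X^n + p) = 'X^n + re_poly p.
Proof.
apply/polyP=> i; rewrite !(coefD, coef_map, coefXn) /= raddfD /=.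
by congr (_ + _); case: eqP.
Qed.

Section Stable.
Variables (N : nat) (F : {ffun I -> C} -> C) (g : {ffun I -> R} -> R).
Hypotheses (sF : stable N F) (Fg : realizes F g).

(** [Im (p^* * q)] is 0 at the real point [y] and nonpositive at [y + 'i e], so its derivative in
    [e] at 0 is nonpositive; that derivative is the Wronskian. *)
Lemma diagonal_wronskian_le0 k p q y :
  (forall x : C, F (diagonal x) = p.[x]) ->
  (forall x : C, partial F k (diagonal x) = q.[x]) ->
  wronskian (re_poly p) (re_poly q) y <= 0.
Proof.
move=> Fp Fq; set yc := y%:C%C.
have py : p.[yc] = (g (diagonal y))%:C%C by rewrite -Fp -embed_diagonal Fg.
have qy : q.[yc] = (partial g k (diagonal y))%:C%C.
  by rewrite -Fq -embed_diagonal (realizes_partial _ Fg).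
have Im_lim : complex.Im ('i * q^`().[yc] * (p.[yc])^* +
    q.[yc] * ('i * p^`().[yc])^*) =
  complex.Re q^`().[yc] * g (diagonal y) -
  partial g k (diagonal y) * complex.Re p^`().[yc].
  rewrite py qy -complexiE; case: q^`().[yc] => a b; case: p^`().[yc] => c d.
  rewrite -[(g _)%:C%C^*]/((g (diagonal y))%:C^*)%C.
  by rewrite -[('i%C * _)^*]/(('i * (c +i* d))^*)%C; simpc => /=; ring.
rewrite /wronskian !deriv_re_poly !horner_re_poly -/yc.
rewrite [in X in X - _]py [in X in _ - X]qy /= -Im_lim.
apply: lin_lim_Im_le0 (lin_limD
  (lin_limM (lin_lim_deriv q yc 'i) (lin_lim_conj (lin_lim_horner p yc 'i)))
  (lin_limM (lin_lim_cst q.[yc]) (lin_lim_conj (lin_lim_deriv p yc 'i)))).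
move=> e e0; set z := yc + 'i * e%:C%C.
have z0 j : 0 <= complex.Im ((diagonal z : {ffun I -> C}) j).
  by rewrite ffunE /z -complexiE; simpc; rewrite ltW.
have := stable_partial_Im_le0 k sF z0; rewrite Fp Fq.
have eV : (e%:C%C)^-1 = (e^-1)%:C%C by rewrite fmorphV.
rewrite !eV rmorphM rmorphB /=.
have -> : ((e^-1)%:C%C)^* = (e^-1)%:C%C :> C by apply: conjc_real.
have -> : (q.[z] - q.[yc]) * (e^-1)%:C%C * (p.[z])^* +
   q.[yc] * (((p.[z])^* - (p.[yc])^*) * (e^-1)%:C%C) =
   (q.[z] * (p.[z])^* - q.[yc] * (p.[yc])^*) * (e^-1)%:C%C by ring.
have -> : q.[yc] * (p.[yc])^* =
    (partial g k (diagonal y) * g (diagonal y))%:C%C.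
  by rewrite py qy rmorphM /=; congr (_ * _); apply: conjc_real.
case: (q.[z] * _) => a b /= b0; simpc => /=; rewrite pmulr_lle0 ?invr_gt0 //.
Qed.

(** On the diagonal [g] is monic of degree [N] and its partials have lower degree, so
    [one_of_two_gt0_above] applies; by multiaffinity [g - 2 D_j g] is the translate of [g] by
    [-2 e_j]. *)
Lemma one_of_two_shifts k l b :
  (forall x, b <= x -> 0 < mix g k l (diagonal x)) ->
  (forall x, b <= x -> 0 < g (diagonal x - axis k 2)) \/
  (forall x, b <= x -> 0 < g (diagonal x - axis l 2)).
Proof.
have aF := stable_multiaffine sF; have ag := realizes_multiaffine Fg aF.
have [q sq qE] := stable_monic sF 0.
have Fp (x : C) : F (diagonal x) = ('X^N + q).[x].
  by rewrite -[diagonal x]add0r qE hornerD hornerXn.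
have gp x : g (diagonal x) = ('X^N + re_poly q).[x].
  by rewrite -re_polyXnD horner_re_poly -Fp -embed_diagonal Fg.
have part j : exists2 r : {poly R}, (size r <= N)%N &
    (forall x, partial g j (diagonal x) = r.[x]) /\
    forall x, wronskian ('X^N + re_poly q) r x <= 0.
  have [q1 sq1 q1E] := stable_monic sF (0 + axis j 1).
  have Fq (x : C) : partial F j (diagonal x) = (q1 - q).[x].
    rewrite /partial -[diagonal x]add0r addrAC q1E qE hornerD hornerN; ring.
  exists (re_poly (q1 - q)).
    rewrite (leq_trans (size_re_poly _)) // (leq_trans (size_polyD _ _)) //.
    by rewrite geq_max sq1 size_polyN.
  split=> x; last by rewrite -re_polyXnD; apply: (diagonal_wronskian_le0 _ Fp Fq).
  by rewrite horner_re_poly -Fq -embed_diagonal (realizes_partial _ Fg).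
have [r1 s1 [r1E W1]] := part k; have [r2 s2 [r2E W2]] := part l.
have shift j (r : {poly R}) : (forall x, partial g j (diagonal x) = r.[x]) ->
    (forall x, b <= x -> 0 < ('X^N + re_poly q).[x] - 2 * r.[x]) ->
    forall x, b <= x -> 0 < g (diagonal x - axis j 2).
  move=> rE h x /h; rewrite -gp -rE.
  have -> : - axis j 2 = axis j (- 2) :> {ffun I -> R}.
    by apply/ffunP=> i; rewrite !ffunE; case: eqP; rewrite ?oppr0.
  by rewrite ag mulNr.
move=> h; have sq' : (size (re_poly q) <= N)%N := leq_trans (size_re_poly q) sq.
have [x bx|h1|h1] := one_of_two_gt0_above sq' s1 s2 W1 W2 (b := b).
- by have := h x bx; rewrite /mix /pair_partial gp r1E r2E opprD addrA.
- by left; apply: shift r1E h1.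
- by right; apply: shift r2E h1.
Qed.

End Stable.
End DiagonalRestriction.

(** * Iteration over the coordinates *)

Section Iteration.
Variable J : finType.

(** [(j, true)] and [(j, false)] are the two copies of coordinate [j], one for each part of the
    partition. *)
Fixpoint mixes (K : comNzRingType) (F : {ffun J * bool -> K} -> K) (l : seq J) :=
  if l is j :: l' then mix (mixes F l') (j, true) (j, false) else F.

Variable R : rcfType.
Local Notation C := R[i].
Local Notation I := (J * bool)%type.
Implicit Types (F : {ffun I -> C} -> C) (g : {ffun I -> R} -> R).
Implicit Types (l : seq J) (b d t x : R).

Lemma stable_mixes N F l : stable N F -> stable N (mixes F l).
Proof. by move=> sF; elim: l => [|j l IHl] //=; apply: stable_mix. Qed.

Lemma realizes_mixes F g l : realizes F g -> realizes (mixes F l) (mixes g l).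
Proof. by move=> Fg; elim: l => [|j l IHl] //=; apply: realizes_mix. Qed.

Lemma mixes_translate g l v y :
  mixes (fun u => g (u + v)) l y = mixes g l (y + v).
Proof.
elim: l y => [|j l IHl] y //=.
by rewrite /mix /pair_partial /partial !IHl ![y + v + _]addrAC.
Qed.

(** The invariant bounds the potentials of all [j], treated or not, by [1 - 1 / d]: each
    [barrier_step] uses one of these bounds and preserves all of them. *)
Lemma barrier N F g y d l : stable N F -> realizes F g -> 0 < d -> above g y ->
  (forall j, d * pair_partial g (j, true) (j, false) y <= (d - 1) * g y) ->
  above (mixes g l) (y + \sum_(j <- l) (axis (j, true) d + axis (j, false) d)).
Proof.
move=> sF Fg d0 gy potential.
pose yl r := y + \sum_(j <- r) (axis (j, true) d + axis (j, false) d).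
suff [] : above (mixes g l) (yl l) /\ forall j,
  d * pair_partial (mixes g l) (j, true) (j, false) (yl l) <=
  (d - 1) * mixes g l (yl l) by [].
elim: l => [|j l [gl potl]]; first by rewrite /yl big_nil addr0.
have sFl := stable_mixes l sF; have Fgl := realizes_mixes l Fg.
have [] := barrier_step sFl Fgl d0 gl (potl j).
have -> : yl l + axis (j, true) d + axis (j, false) d = yl (j :: l).
  by rewrite /yl big_cons -!addrA; congr (_ + _); rewrite addrC addrA.
move=> gjl dec; split=> // k; have y0 := above_gt0 gl.
rewrite -(ler_pM2r y0) -mulrA (le_trans (ler_wpM2l (ltW d0) (dec _ _))) //.
by rewrite mulrA [leRHS]mulrAC ler_wpM2r // ltW ?(above_gt0 gjl).
Qed.

(** The operator of the head [j] is outermost, so [one_of_two_shifts] picks its side; the chosen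
    shift commutes with the remaining operators, and the induction continues with the translate of
    [g]. *)
Lemma select_shifts N F g b l : uniq l -> stable N F -> realizes F g ->
  (forall x, b <= x -> 0 < mixes g l (diagonal x)) ->
  exists c : J -> bool,
    forall x, b <= x -> 0 < g (diagonal x - \sum_(j <- l) axis (j, c j) 2).
Proof.
elim: l F g => [|j l IHl] F g /=.
  move=> _ sF Fg h; exists (fun=> true) => x bx; rewrite big_nil subr0; exact: h.
move=> /andP[jl ul] sF Fg h.
have [c0 h0] : exists c0, forall x, b <= x ->
    0 < mixes g l (diagonal x - axis (j, c0) 2).
  have [h1|h1] :=
    one_of_two_shifts (stable_mixes l sF) (realizes_mixes l Fg) h.
  - by exists true.
  - by exists false.
have [x bx|c hc] := IHl _ _ ul (stable_translate (- axis (j, c0) 2) sF)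
    (realizes_translate (- axis (j, c0) 2) Fg).
  by rewrite mixes_translate h0.
exists (fun i => if i == j then c0 else c i) => x bx.
have := hc x bx; rewrite big_cons eqxx opprD addrA addrAC.
congr (0 < g (_ - _ - _)); apply: eq_big_seq => i il.
by case: eqP => // ij; rewrite -ij il in jl.
Qed.

Theorem exists_shifts N F g d t : stable N F -> realizes F g -> 0 < d ->
  above g (diagonal t) ->
  (forall j, d * pair_partial g (j, true) (j, false) (diagonal t) <=
             (d - 1) * g (diagonal t)) ->
  exists c : J -> bool, forall x, t + d <= x ->
    0 < g [ffun k : I => x - if c k.1 == k.2 then 2 else 0].
Proof.
move=> sF Fg d0 gt potential.
have gl := barrier (enum J) sF Fg d0 gt potential.
have sumE (K : nmodType) (f : J -> {ffun I -> K}) k :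
    (\sum_(j <- enum J) f j) k = \sum_j f j k.
  by rewrite big_enum sum_ffunE.
have [x tx|c hc] := select_shifts (enum_uniq J) sF Fg (b := t + d).
  have := gl (diagonal (x - (t + d))).
  (* Each coordinate receives exactly one shift by [d], which brings the point to
     [diagonal (t + d)]. *)
  have -> : diagonal t +
     \sum_(j <- enum J) (axis (j, true) d + axis (j, false) d) +
     diagonal (x - (t + d)) = diagonal x.
    apply/ffunP=> -[i b]; rewrite !ffunE sumE (bigD1 i) //= big1 => [|j /negPf ji].
      rewrite !ffunE !xpair_eqE !eqxx; case: b => /=; ring.
    by rewrite !ffunE !xpair_eqE eq_sym ji addr0.
  by apply=> k; rewrite ffunE subr_ge0.
exists c => x /hc; congr (0 < g _); apply/ffunP=> -[i b].
rewrite !ffunE sumE (bigD1 i) //= big1 => [|j /negPf ji]; last first.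
  by rewrite ffunE xpair_eqE eq_sym ji.
by rewrite addr0 ffunE xpair_eqE eqxx eq_sym.
Qed.

End Iteration.

(** * Determinants of rank-one updates *)

Section RankOneDeterminant.
Variables (K : fieldType) (n : nat).
Implicit Types (M : 'M[K]_n) (u : 'cV[K]_n) (v : 'rV[K]_n).

(** A Schur complement; in the bordered matrix [v] occupies a single row, in which the determinant
    is linear. *)
Lemma det_add_rank1E M u v :
  \det (M + u *m v) = \det (block_mx M (- u) v (1%:M : 'M_1)).
Proof.
have -> : block_mx M (- u) v 1%:M =
    block_mx 1%:M (- u) 0 1%:M *m block_mx (M + u *m v) 0 v 1%:M.
  by rewrite mulmx_block !mul1mx !mul0mx !mulmx1 mulNmx addrK !add0r.
by rewrite det_mulmx det_ublock det_lblock !det1 !mulr1 mul1r.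
Qed.

Lemma det_add_rank1 M u v (t : K) :
  \det (M + t *: (u *m v)) = \det M + t * (\det (M + u *m v) - \det M).
Proof.
have E0 : \det M = \det (M + u *m 0) by rewrite mulmx0 addr0.
rewrite scalemxAr E0 !det_add_rank1E.
have row'E v1 v2 : row' (rshift n 0) (block_mx M (- u) v1 (1%:M : 'M_1)) =
    row' (rshift n 0) (block_mx M (- u) v2 1%:M).
  apply/matrixP=> i j; rewrite mxE [RHS]mxE.
  have := neq_lift (rshift n (0 : 'I_1)) i.
  case: (split_ordP (lift (rshift n (0 : 'I_1)) i)) => k ->.
    by rewrite !block_mxEv !col_mxEu.
  by rewrite (ord1 k) eqxx.
(* The last row [(t v, 1)] is [t (v, 1) + (1 - t) (0, 1)]. *)
rewrite (@determinant_multilinear _ _ _ (block_mx M (- u) v 1%:M)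
  (block_mx M (- u) 0 1%:M) (rshift n 0) t (1 - t)) //; first ring.
have rowE v1 : row (rshift n 0) (block_mx M (- u) v1 (1%:M : 'M_1)) = row_mx v1 1%:M.
  by rewrite block_mxEv -row_dsubmx col_mxKd row_id.
rewrite !rowE !scale_row_mx add_row_mx scaler0 addr0 -scalerDl addrC subrK.
by rewrite scale1r.
Qed.

Lemma det_scalar_add_rank1 (a : K) u v : a != 0 ->
  \det (a%:M + u *m v) = a ^+ n * (1 + a^-1 * (v *m u) 0 0).
Proof.
move=> a0; rewrite det_add_rank1E.
have -> : block_mx a%:M (- u) v 1%:M = block_mx 1%:M 0 (a^-1 *: v) 1%:M *m
    block_mx a%:M (- u) 0 (1%:M + a^-1 *: (v *m u)).
  rewrite mulmx_block !mul1mx !mul0mx !addr0 mul_mx_scalar scalerA.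
  by rewrite divff // scale1r -scalemxAl mulmxN scalerN addrCA addNr addr0.
by rewrite det_mulmx det_lblock det_ublock !det1 !mul1r det_scalar det_mx11 !mxE.
Qed.

End RankOneDeterminant.

(** * Hermitian forms and eigenvalues *)

Section SpectralBound.
Variables (C : numClosedFieldType) (n : nat).
Local Open Scope sesquilinear_scope.

Lemma sum_mul_conjE (u v : 'rV[C]_n) : (u *m v ^t*) 0 0 = \sum_i u 0 i * (v 0 i)^*.
Proof. by rewrite mxE; apply: eq_bigr => i _; rewrite !mxE. Qed.

(** After unitary diagonalization, each eigenvalue is a real zero of [\det (x%:M - H)], hence below
    [b]. *)
Lemma hermitian_form_le (H : 'M[C]_n) (b : C) : H \is hermsymmx ->
  (forall x, x \is Num.real -> b <= x -> \det (x%:M - H) != 0) ->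
  b \is Num.real -> forall u : 'rV_n, (u *m H *m u ^t*) 0 0 <= b * dotmx u u.
Proof.
move=> hH dH b_real u.
have /orthomx_spectralP := hermitian_normalmx hH.
have := hermitian_spectral_diag_real hH; have := spectral_unitarymx H.
set P := spectralmx H; set D := spectral_diag H => P_unitary D_real HE.
have PV : invmx P = P ^t* by rewrite invmx_unitary.
have D_lt i : D 0 i < b.
  have Dr : D 0 i \is Num.real by apply: (mxOverP D_real).
  rewrite real_ltNge //; apply/negP => /(dH _ Dr)/negP; apply.
  rewrite HE.
  have -> : (D 0 i)%:M = invmx P *m (D 0 i)%:M *m P.
    by rewrite mul_mx_scalar -scalemxAl mulVmx ?unitarymx_unit // scalemx1.
  rewrite -mulmxBl -mulmxBr !det_mulmx -diag_const_mx -raddfB /= det_diag.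
  by rewrite (bigD1 i) //= !mxE subrr mul0r mulr0 mul0r.
pose v := u *m P ^t*.
have vE : u *m H *m u ^t* = v *m diag_mx D *m v ^t*.
  by rewrite /v HE PV !trmx_mul !map_mxM trmxCK !mulmxA.
have uE : u *m u ^t* = v *m v ^t*.
  rewrite /v !trmx_mul !map_mxM trmxCK !mulmxA -[_ *m _ *m P]mulmxA -PV.
  by rewrite mulVmx ?unitarymx_unit // mulmx1.
rewrite dotmxE uE vE !sum_mul_conjE mulr_sumr ler_sum // => i _.
rewrite mul_mx_diag mxE -mulrA mulrCA ler_wpM2r ?mul_conjC_ge0 //.
exact: ltW.
Qed.

(* Polarization: [H i j] is read off the form at [e_i + e_j] and [e_i + 'i e_j]. *)
Lemma form_eq0 (H : 'M[C]_n) :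
  (forall u : 'rV_n, (u *m H *m u ^t*) 0 0 = 0) -> H = 0.
Proof.
move=> h; pose B (x y : 'rV_n) := (x *m H *m y ^t*) 0 0.
have BD x y c : B (x + c *: y) (x + c *: y) =
    B x x + c^* * B x y + c * B y x + c * c^* * B y y.
  rewrite /B linearD linearZ /= map_mxD map_mxZ !(mulmxDl, mulmxDr).
  by rewrite -!(scalemxAl, scalemxAr) !mxE; ring.
have Bz x y c : c^* * B x y + c * B y x = 0.
  have := BD x y c; rewrite /B !h mulr0 add0r addr0 => <- //.
apply/matrixP=> i j; rewrite mxE.
have HE : H i j = B (delta_mx 0 i) (delta_mx 0 j).
  rewrite /B -rowE mxE (bigD1 j) //= !mxE !eqxx conjC1 mulr1 big1 ?addr0 // => k kj.
  by rewrite !mxE eqxx /= (negPf kj) conjC0 mulr0.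
have := Bz (delta_mx 0 i) (delta_mx 0 j) 1.
have := Bz (delta_mx 0 i) (delta_mx 0 j) 'i.
rewrite -HE conjC1 conjCi !mul1r mulNr => /eqP.
rewrite addrC subr_eq0 => /eqP/(mulfI (neq0Ci C)) -> /eqP.
by rewrite -mulr2n mulrn_eq0 => /eqP.
Qed.

End SpectralBound.

(** Commuting with conjugation makes [F] real at real points. *)
Lemma realizes_restrict (R : rcfType) (I : finType) N
  (F : {ffun I -> R[i]} -> R[i]) : stable N F -> realizes F (real_part F).
Proof.
move=> sF y; have := stable_conj sF (embed y).
have -> : [ffun k => (embed y k)^*] = embed y.
  by apply/ffunP=> k; rewrite !ffunE; apply: conjc_real.
rewrite /real_part -[(F _)^*]/((F (embed y))^*)%C.
by case: (F _) => a b [] /= /esym/eqP; rewrite eqNr => /eqP ->.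
Qed.

(** * The product of two copies in separate variables *)

Section DoubledProduct.
Variables (R : rcfType) (J : finType).
Local Notation C := R[i].
Implicit Types (j : J) (b : bool) (N : nat).

Definition slice (K : Type) (z : {ffun J * bool -> K}) b : {ffun J -> K} :=
  [ffun j => z (j, b)].

Definition doubled (K : nzRingType) (F : {ffun J -> K} -> K) z :=
  F (slice z true) * F (slice z false).

Lemma slice_axis (K : comNzRingType) z j b b' (t : K) :
  slice (z + axis (j, b) t) b' = slice z b' + axis j (if b' == b then t else 0).
Proof.
apply/ffunP=> i; rewrite !ffunE xpair_eqE; congr (_ + _).
by case: eqP => //= _; case: eqP.
Qed.

Lemma axis0 (K : comNzRingType) j : axis j (0 : K) = 0.
Proof. by apply/ffunP=> i; rewrite !ffunE; case: eqP. Qed.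

Lemma slice_diagonal (K : comNzRingType) z b (x : K) :
  slice (z + diagonal x) b = slice z b + diagonal x.
Proof. by apply/ffunP=> j; rewrite !ffunE. Qed.

Lemma stable_doubled N (F : {ffun J -> C} -> C) :
  stable N F -> stable (N + N) (doubled F).
Proof.
case=> aF nF cF mF; split.
- move=> z [j b] t; rewrite /partial /doubled !slice_axis.
  case: b => /=; rewrite axis0 addr0 !aF /partial; ring.
- by move=> z z0; rewrite mulf_neq0 // nF // => j; rewrite ffunE.
- move=> z; rewrite /doubled rmorphM /= -!cF.
  by congr (F _ * F _); apply/ffunP=> j; rewrite !ffunE.
move=> z; have [p sp pE] := mF (slice z true); have [q sq qE] := mF (slice z false).
exists ('X^N * q + 'X^N * p + p * q).
  have sM (a b : {poly C}) : (size a <= N.+1)%N -> (size b <= N)%N ->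
      (size (a * b)%R <= N + N)%N.
    move=> sa sb; have [->|a0] := eqVneq a 0; first by rewrite mul0r size_poly0.
    by rewrite (leq_trans (size_polyMleq _ _)) // -subn1 leq_subLR add1n -addSn leq_add.
  have sX : (size ('X^N : {poly C}) <= N.+1)%N by rewrite size_polyXn.
  have sD (a b : {poly C}) : (size a <= N + N)%N -> (size b <= N + N)%N ->
      (size (a + b)%R <= N + N)%N.
    by move=> sa sb; rewrite (leq_trans (size_polyD _ _)) // geq_max sa.
  by rewrite !sD ?sM // leqW.
move=> x; rewrite /doubled !slice_diagonal pE qE.
by rewrite !(hornerD, hornerM, hornerXn) exprD; ring.
Qed.

Lemma realizes_doubled (F : {ffun J -> C} -> C) (g : {ffun J -> R} -> R) :
  realizes F g -> realizes (doubled F) (doubled g).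
Proof.
move=> Fg y; rewrite /doubled rmorphM /= -!Fg.
by congr (F _ * F _); apply/ffunP=> j; rewrite !ffunE.
Qed.

Lemma above_doubled (g : {ffun J -> R} -> R) y :
  (forall b, above g (slice y b)) -> above (doubled g) y.
Proof.
move=> gy v v0; rewrite /doubled.
have E b : slice (y + v) b = slice y b + slice v b.
  by apply/ffunP=> j; rewrite !ffunE.
by rewrite !E mulr_gt0 //; apply: gy => j; rewrite ffunE.
Qed.

Lemma pair_partial_doubled (g : {ffun J -> R} -> R) j t :
  pair_partial (doubled g) (j, true) (j, false) (diagonal t) =
  2 * (partial g j (diagonal t) * g (diagonal t)).
Proof.
rewrite /pair_partial /partial /doubled !slice_axis /= !axis0 !addr0.
have E b : slice (diagonal t) b = diagonal t by apply/ffunP=> i; rewrite !ffunE.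
rewrite !E; ring.
Qed.

End DoubledProduct.

(** * The determinant of a pencil of rank-one matrices *)

Section Pencil.
Variables (R : rcfType) (n : nat) (J : finType).
Local Notation C := R[i].
Local Open Scope sesquilinear_scope.
Variables (c : R) (w : J -> 'rV[C]_n).
Implicit Types (j k : J) (u : 'rV[C]_n) (z : {ffun J -> C}) (y : {ffun J -> R}).
Hypothesis c_gt0 : 0 < c.

Definition rank1 j : 'M[C]_n := c%:C%C *: ((w j) ^t* *m w j).

Hypothesis sum_rank1 : \sum_j rank1 j = 1%:M.

Definition pencil (z : {ffun J -> C}) : 'M[C]_n := \sum_j z j *: rank1 j.

Lemma pencilD z z' : pencil (z + z') = pencil z + pencil z'.
Proof.
by rewrite /pencil -big_split; apply: eq_bigr => j _; rewrite ffunE scalerDl.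
Qed.

Lemma pencil_axis j t : pencil (axis j t) = t *: rank1 j.
Proof.
rewrite /pencil (bigD1 j) //= ffunE eqxx big1 ?addr0 // => k /negPf kj.
by rewrite ffunE kj scale0r.
Qed.

Lemma pencil_diagonal x : pencil (diagonal x) = x%:M.
Proof.
rewrite /pencil -scalemx1 -sum_rank1 scaler_sumr.
by apply: eq_bigr => j _; rewrite ffunE.
Qed.

Lemma adjZ p q (a : C) (M : 'M[C]_(p, q)) : (a *: M) ^t* = a^* *: M ^t*.
Proof. by apply/matrixP=> i k; rewrite !mxE rmorphM. Qed.

Lemma adj_rank1 j : (rank1 j) ^t* = rank1 j.
Proof.
rewrite /rank1 adjZ trmx_mul map_mxM trmxCK; congr (_ *: _).
exact: conjc_real.
Qed.

Lemma rank1_form u j :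
  (u *m rank1 j *m u ^t*) 0 0 = c%:C%C * `|dotmx u (w j)| ^+ 2.
Proof.
rewrite /rank1 -scalemxAr -scalemxAl mxE; congr (_ * _).
have -> : u *m ((w j) ^t* *m w j) *m u ^t* =
    (u *m (w j) ^t*) *m (w j *m u ^t*) by rewrite !mulmxA.
rewrite mxE big_ord1 normCK dotmxE; congr (_ * _).
have -> : w j *m u ^t* = (u *m (w j) ^t*) ^t*.
  by rewrite trmx_mul map_mxM trmxCK.
by rewrite mxE [in LHS]mxE.
Qed.

Lemma pencil_form u z :
  (u *m pencil z *m u ^t*) 0 0 = \sum_j z j * (c%:C%C * `|dotmx u (w j)| ^+ 2).
Proof.
rewrite /pencil mulmx_sumr mulmx_suml summxE; apply: eq_bigr => j _.
by rewrite -rank1_form -scalemxAr -scalemxAl mxE.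
Qed.

(** For [u] in the kernel, the form of [pencil z] at [u] has as imaginary part a sum of [Im (z j)]
    times nonnegative [a j]. So every [a j] vanishes, but they sum to [dotmx u u > 0]. *)
Lemma det_pencil_neq0 z : (forall j, 0 < complex.Im (z j)) ->
  \det (pencil z) != 0.
Proof.
move=> z0; apply/det0P => -[u u0 uz].
have := pencil_form u z; rewrite uz mul0mx mxE => /(congr1 (@complex.Im R)).
have := pencil_form u (diagonal 1).
rewrite pencil_diagonal mulmx1 -dotmxE => uu.
pose a j := complex.Re (c%:C%C * `|dotmx u (w j)| ^+ 2).
have form_ge0 j : 0 <= c%:C%C * `|dotmx u (w j)| ^+ 2.
  by rewrite mulr_ge0 ?exprn_ge0 // ler0c ltW.
have aE j : c%:C%C * `|dotmx u (w j)| ^+ 2 = (a j)%:C%C.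
  by rewrite RRe_real // ger0_real.
have a_ge0 j : 0 <= a j by rewrite -ler0c -aE.
rewrite raddf_sum /= => /esym.
under eq_bigr => j _ do rewrite aE.
have ImE (x : C) (r : R) : complex.Im (x * r%:C%C) = complex.Im x * r.
  by case: x => x1 x2; simpc.
under eq_bigr => j _ do rewrite ImE.
have nonneg j : true -> 0 <= complex.Im (z j) * a j.
  by move=> _; rewrite mulr_ge0 // ltW.
move=> /(psumr_eq0P nonneg) za.
have : 0 < dotmx u u by rewrite dnorm_gt0.
rewrite uu big1 ?ltxx // => j _; have /eqP := za j isT.
by rewrite mulf_eq0 gt_eqF //= aE => /eqP ->; rewrite mulr0.
Qed.

Lemma stable_det_pencil : stable n (fun z => \det (pencil z)).
Proof.
split.
- move=> z k t; rewrite /partial !pencilD !pencil_axis scale1r /rank1.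
  by rewrite scalemxAl det_add_rank1.
- exact: det_pencil_neq0.
- move=> z; have -> : pencil [ffun k => (z k)^*] = (pencil z) ^t*.
    rewrite /pencil !linear_sum /= map_mx_sum; apply: eq_bigr => j _.
    by rewrite ffunE adjZ adj_rank1.
  by rewrite det_map_mx det_tr.
(* Translation by [diagonal x] adds [x%:M], which gives the characteristic polynomial of
   [- pencil z], monic of degree [n]. *)
move=> z; exists (char_poly (- pencil z) - 'X^n) => [|x].
  apply/leq_sizeP => i; rewrite leq_eqVlt coefB coefXn => /predU1P[<-|ni].
    rewrite eqxx; have /monicP := char_poly_monic (- pencil z).
    by rewrite lead_coefE size_char_poly => ->; rewrite subrr.
  by rewrite nth_default ?size_char_poly // gtn_eqF // subrr.
rewrite pencilD pencil_diagonal hornerD hornerN hornerXn [RHS]addrC subrK.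
rewrite /char_poly -horner_evalE -det_map_mx; congr (\det _).
apply/matrixP=> i j; rewrite !mxE /= horner_evalE hornerD hornerN hornerC hornerMn.
by rewrite hornerX opprK addrC.
Qed.

Definition rdet := real_part (fun z => \det (pencil z)).

Lemma realizes_rdet : realizes (fun z => \det (pencil z)) rdet.
Proof. exact: realizes_restrict stable_det_pencil. Qed.

Let multiaffine_rdet : multiaffine rdet :=
  realizes_multiaffine realizes_rdet (stable_multiaffine stable_det_pencil).

Lemma rdet_diagonal t : rdet (diagonal t) = t ^+ n.
Proof.
apply: (@complexI R); rewrite -realizes_rdet embed_diagonal pencil_diagonal.
by rewrite det_scalar rmorphXn.
Qed.

(** By homogeneity it is enough to look at ['i y], a point of the upper half-planes. *)
Lemma rdet_neq0 y : (forall j, 0 < y j) -> rdet y != 0.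
Proof.
move=> y0; rewrite -(inj_eq (@complexI R)) -realizes_rdet.
have : \det (pencil [ffun j => 'i%C * (embed y j)]) != 0.
  by apply: det_pencil_neq0 => j; rewrite !ffunE; simpc; apply: y0.
have -> : pencil [ffun j => 'i%C * (embed y j)] = 'i%C *: pencil (embed y).
  by rewrite scaler_sumr; apply: eq_bigr => j _; rewrite ffunE scalerA.
by rewrite detZ mulf_eq0 negb_or => /andP[].
Qed.

(** On the diagonal [rdet] is [t ^+ n]. Along an axis it is affine, so a loss of positivity would
    produce a zero in the open positive orthant. *)
Lemma above_rdet t : 0 < t -> above rdet (diagonal t).
Proof.
move=> t0 v v0.
suff : (forall j, 0 < (diagonal t + v) j) /\ 0 < rdet (diagonal t + v) by case.
have : (forall j, 0 < (diagonal t : {ffun J -> R}) j) /\ 0 < rdet (diagonal t).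
  by split=> [j|]; rewrite ?ffunE // rdet_diagonal exprn_gt0.
apply: (@orthant_ind _ _ (fun y y' => (forall j, 0 < y j) /\ 0 < rdet y ->
  (forall j, 0 < y' j) /\ 0 < rdet y')) v0 => //.
  by move=> u1 u2 u3 h12 h23 /h12.
move=> y k r r0 [y0 gy].
have ys s : 0 <= s -> forall j, 0 < (y + axis k s) j.
  by move=> s0 j; rewrite ffunE ltr_wpDr // axis_ge0.
split; first exact: ys.
rewrite multiaffine_rdet ltNge; apply/negP => le0.
have p_lt0 : partial rdet k y < 0.
  rewrite ltNge; apply/negP => p_ge0.
  by have := mulr_ge0 r0 p_ge0; lra.
have s0 : 0 <= - rdet y / partial rdet k y.
  by rewrite mulNr -mulrN -invrN divr_ge0 ?ltW // oppr_gt0.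
have /negP := rdet_neq0 (ys _ s0); apply.
have p_neq0 : partial rdet k y != 0 by rewrite lt_eqF.
by rewrite multiaffine_rdet divfK // subrr.
Qed.

(** The matrix determinant lemma at [t%:M]: the logarithmic derivative in direction [j] is the trace
    of [rank1 j] over [t]. *)
Lemma partial_rdet_diagonal j t : 0 < t ->
  t * partial rdet j (diagonal t) =
  rdet (diagonal t) * (c * complex.Re (dotmx (w j) (w j))).
Proof.
move=> t0; apply: (@complexI R); rewrite 2!rmorphM /= rmorphM /=.
have tC0 : t%:C%C != 0 :> C by rewrite (inj_eq (@complexI R) t 0) gt_eqF.
rewrite -(realizes_partial _ realizes_rdet) /partial pencilD pencil_axis.
rewrite embed_diagonal pencil_diagonal scale1r /rank1 scalemxAl.
rewrite det_scalar_add_rank1 // det_scalar rdet_diagonal rmorphXn /=.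
rewrite -scalemxAr mxE -dotmxE RRe_real ?ger0_real ?dnorm_ge0 //.
by field.
Qed.

End Pencil.

(** * From the barrier to the partition *)

Section Partition.
Variables (R : rcfType) (n : nat) (J : finType).
Local Notation C := R[i].
Local Open Scope sesquilinear_scope.

(** The inequality between [d] and [t] says that the two copies of [j] have joint potential at most
    [1 - 1 / d] at [diagonal t]. Then [exists_shifts] excludes eigenvalues in [[t + d, +oo)] for
    twice each partial sum. *)
Lemma rank1_partition (c d t : R) (w : J -> 'rV[C]_n) :
  0 < c -> 0 < d -> 0 < t -> \sum_j rank1 c w j = 1%:M ->
  (forall j, 2 * d * (c * complex.Re (dotmx (w j) (w j))) <= (d - 1) * t) ->
  exists s : J -> bool, forall b (u : 'rV_n),
    2 * (c%:C%C * \sum_(j | s j == b) `|dotmx u (w j)| ^+ 2) <=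
    (t + d)%:C%C * dotmx u u.
Proof.
move=> c0 d0 t0 sum1 small.
have sF := stable_doubled (stable_det_pencil c0 sum1).
have Fg := realizes_doubled (realizes_rdet c0 sum1).
have gd b : slice (diagonal t : {ffun J * bool -> R}) b = diagonal t.
  by apply/ffunP=> i; rewrite !ffunE.
have gt : above (doubled (rdet c w)) (diagonal t).
  by apply: above_doubled => b; rewrite gd; apply: above_rdet.
have [j|s hs] := exists_shifts sF Fg d0 gt.
  rewrite pair_partial_doubled /doubled !gd.
  have g0 := above_gt0 (above_rdet c0 sum1 t0).
  have := partial_rdet_diagonal c0 sum1 j t0; move: g0 (small j).
  set g := rdet c w _; set p := partial _ _ _; set a := c * _ => g0 aj pE.
  rewrite -(ler_pM2l t0).
  have -> : t * (d * (2 * (p * g))) = (2 * d * a) * (g * g).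
    by transitivity (2 * d * g * (t * p)); [ring | rewrite pE; ring].
  have -> : t * ((d - 1) * (g * g)) = ((d - 1) * t) * (g * g) by ring.
  by rewrite ler_pM2r ?mulr_gt0.
exists s => b u.
pose z := [ffun j => if s j == b then 2 else 0 : C].
have formE : (u *m pencil c w z *m u ^t*) 0 0 =
    2 * (c%:C%C * \sum_(j | s j == b) `|dotmx u (w j)| ^+ 2).
  rewrite pencil_form !mulr_sumr [in RHS]big_mkcond /=; apply: eq_bigr => j _.
  by rewrite ffunE; case: eqP; rewrite ?mul0r.
rewrite -formE; apply: hermitian_form_le.
- apply/is_hermitianmxP; rewrite expr0 scale1r.
  rewrite /pencil !linear_sum /= map_mx_sum; apply: eq_bigr => j _.
  rewrite adjZ adj_rank1 ffunE; congr (_ *: _).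
  by case: eqP; rewrite ?conjC_nat ?conjC0.
- move=> x /complex_realP[r ->]; rewrite lecR => /hs; rewrite /doubled.
  have dE b' : \det ((r%:C)%C%:M - pencil c w [ffun j => if s j == b' then 2 else 0]) =
    (rdet c w (slice [ffun k => r - (if s k.1 == k.2 then 2 else 0)] b'))%:C%C.
    rewrite -(realizes_rdet c0 sum1) -(pencil_diagonal sum1) -scaleN1r.
    rewrite /pencil scaler_sumr -big_split /=; congr (\det _); apply: eq_bigr => j _.
    rewrite !ffunE scaleN1r -scalerBl rmorphB /=; congr ((_ - _) *: _).
    by case: eqP; rewrite ?rmorph_nat ?rmorph0.
  rewrite dE -(rmorph0 (real_complex R)) (inj_eq (@complexI R)).
  (* The product of the two determinants is positive, so neither vanishes; this serves both parts at
     once. *)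
  by case: b {z formE} => h; apply: contraTneq h => ->; rewrite ?mul0r ?mulr0 ltxx.
- by apply/complex_realP; exists (t + d).
Qed.

Lemma dotmxZl (a : C) (u v : 'rV[C]_n) : dotmx (a *: u) v = a * dotmx u v.
Proof. by rewrite !dotmxE -scalemxAl mxE. Qed.

(** Rescaling to unit length extends the frame identity to an equality of Hermitian forms at every
    [u], and [form_eq0] lifts it to matrices. *)
Lemma sum_rank1_eq1 (eta : R) (w : J -> 'rV[C]_n) : 0 < eta ->
  (forall u : 'rV[C]_n, l2norm u = 1 ->
     \sum_j `|dotmx u (w j)| ^+ 2 = eta%:C%C) ->
  \sum_j rank1 eta^-1 w j = 1%:M.
Proof.
move=> eta0 frame; apply/eqP; rewrite -subr_eq0; apply/eqP/form_eq0 => u.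
have [->|u0] := eqVneq u 0; first by rewrite !mul0mx mxE.
have uu0 : 0 < dotmx u u by rewrite dnorm_gt0.
have r0 : 0 < l2norm u by rewrite sqrtC_gt0.
have r2 : l2norm u ^+ 2 = dotmx u u by rewrite sqrtCK.
have rV0 : 0 <= (l2norm u)^-1 by rewrite invr_ge0 ltW.
have unit_u : l2norm ((l2norm u)^-1 *: u) = 1.
  rewrite {1}/l2norm dotmxZl [dotmx u _]dotmxE adjZ -scalemxAr mxE -dotmxE.
  rewrite mulrA -normCK ger0_norm // -r2 -exprMn mulVf ?gt_eqF //.
  by rewrite expr1n sqrtC1.
have := frame _ unit_u.
under eq_bigr => j _ do rewrite dotmxZl normrM exprMn.
rewrite -mulr_sumr ger0_norm // exprVn r2 => frame_u.
have {frame_u} sumE : \sum_j `|dotmx u (w j)| ^+ 2 = dotmx u u * eta%:C%C.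
  by rewrite -frame_u mulVKf ?gt_eqF.
have -> : \sum_j rank1 eta^-1 w j = pencil eta^-1 w [ffun=> 1].
  by apply: eq_bigr => j _; rewrite ffunE scale1r.
have mxB (A B : 'M[C]_1) : (A - B) 0 0 = A 0 0 - B 0 0 by rewrite !mxE.
rewrite mulmxBr mulmxBl mulmx1 mxB pencil_form -dotmxE.
under eq_bigr => j _ do rewrite ffunE mul1r.
rewrite -mulr_sumr sumE mulrCA -rmorphM mulVf ?gt_eqF //.
by rewrite rmorph1 mulr1 subrr.
Qed.


End Partition.

Local Open Scope complex_scope.

Theorem mainTheorem3 (R : realType) :
  exists eta theta : R,
    [/\ 2 <= eta, 0 < theta &
      forall (m d : nat) (w : 'I_m -> 'rV[R[i]]_d),
        (0 < m)%N -> (0 < d)%N ->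
        (forall i : 'I_m, l2norm (w i) <= 1) ->
        (forall u : 'rV[R[i]]_d, l2norm u = 1 ->
           \sum_(i < m) `|dotmx u (w i)| ^+ 2 = eta%:C) ->
        exists S1 S2 : {set 'I_m},
          [/\ S1 :|: S2 = [set: 'I_m],
              [disjoint S1 & S2],
              (forall u : 'rV[R[i]]_d, l2norm u = 1 ->
                 \sum_(i in S1) `|dotmx u (w i)| ^+ 2 <= (eta - theta)%:C) &
              (forall u : 'rV[R[i]]_d, l2norm u = 1 ->
                 \sum_(i in S2) `|dotmx u (w i)| ^+ 2 <= (eta - theta)%:C)]].
Proof.
(* The barrier bounds [2 / 18] of each partial sum by [16 / 9], hence the sum itself by
   [16 = 18 - 2]. *)
exists 18, 2; split=> [||m d w _ _ w_le1 frame]; [lra|lra|].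
have sum1 : \sum_j rank1 18^-1 w j = 1%:M by apply: sum_rank1_eq1 => //; lra.
(* These values minimize [t + d] subject to [2 * d / 18 <= (d - 1) * t], which holds with
   equality. *)
have [|||j|s hs] := rank1_partition (d := 4 / 3) (t := 4 / 9) _ _ _ sum1.
1-3: lra.
  have : complex.Re (dotmx (w j) (w j)) <= 1.
    have w2 : dotmx (w j) (w j) <= 1.
      by rewrite -[dotmx _ _]sqrtCK exprn_ile1 // ?w_le1 // sqrtC_ge0 dnorm_ge0.
    by move: w2; rewrite lecE => /andP[].
  lra.
have bound b (u : 'rV[R[i]]_d) : l2norm u = 1 ->
    \sum_(i | s i == b) `|dotmx u (w i)| ^+ 2 <= (18 - 2)%:C.
  move=> u1; have uu : dotmx u u = 1.
    by rewrite -[dotmx _ _]sqrtCK -/(l2norm u) u1 expr1n.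
  have := hs b u; rewrite uu mulr1.
  have c9 : (0 : R[i]) < 9 by [].
  rewrite -(ler_pM2l c9).
  have -> : 9 * (2 * ((18^-1)%:C * \sum_(j | s j == b) `|dotmx u (w j)| ^+ 2)) =
     \sum_(j | s j == b) `|dotmx u (w j)| ^+ 2 :> R[i].
    rewrite !mulrA -[X in X * _ = _](_ : 1 = _) ?mul1r //.
    by rewrite fmorphV rmorph_nat; field.
  have -> // : 9 * (4 / 9 + 4 / 3)%:C = (18 - 2)%:C :> R[i].
  by rewrite -(rmorph_nat (real_complex R) 9) -rmorphM /=; congr (_%:C); field.
exists [set i | s i == true], [set i | s i == false]; split.
- by apply/setP=> i; rewrite !inE; case: (s i).
- by rewrite disjoints_subset; apply/subsetP=> i; rewrite !inE => /eqP ->.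
- by move=> u u1; under eq_bigl => i do rewrite inE; apply: bound.
- by move=> u u1; under eq_bigl => i do rewrite inE; apply: bound.
Qed.
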